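(* Let $A=(a_{ij})\in\mathbb{R}_{\max}^{n\times n}$ have tropical algebraic eigenvalue $\lambda\in\mathbb{R}_{\max}$. Assume that there exists $q\in[n]$ such that $a_{qq}\ge\lambda$, and let $p\in[n]$ satisfy $$\min_{i\in[n]}a_{ii}=a_{pp}.$$ Define $x_p=0$ and $x_i=\varepsilon$ for all $i\in[n]\setminus\{p,q\}$. To determine $x_q$, consider the following two cases: (1) If $\lambda+a_{qq}\le 2\max\{a_{pq},a_{qp}\}$, set $$x_q=\lambda-\max\{a_{pq},a_{qp}\}.$$ (2) If $\lambda+a_{qq}\ge 2\max\{a_{pq},a_{qp}\}$, set $$x_q=\frac{\lambda-a_{qq}}{2}.$$ Then the vector $x=(x_i)\in\mathbb{R}_{\max}^n$ is a generalized tropical eigenvector associated with $\lambda$, such that $\Vert x\Vert=0$.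
   Context: $\mathbb{R}_{\max}=\mathbb{R}\cup\{-\infty\}$ is the tropical (max-plus) semiring with $a\oplus b=\max\{a,b\}$, $a\otimes b=a+b$, and additive neutral element $\varepsilon=-\infty$ (absorbing for $\otimes$); the tropical inverse of a non-$\varepsilon$ element $a$ is $a^{\otimes -1}=-a$. Write $[n]=\{1,\dots,n\}$. Matrix and vector operations are defined as in classical linear algebra with $(\oplus,\otimes)$ in place of $(+,\times)$; in particular $x^T\otimes A\otimes x=\max_{i,j\in[n]}(x_i+a_{ij}+x_j)$ and $x^T\otimes x=2\max_i x_i$. Tropical algebraic eigenvalues: the tropical characteristic polynomial of $A=(a_{ij})\in\mathbb{R}_{\max}^{n\times n}$ is the formal polynomial $P_A(X)=\mathrm{per}(A\oplus X\otimes I)=\bigoplus_{k=0}^n c_{n-k}\otimes X^{\otimes k}$, where $I$ is the tropical identity matrix ($0$ on the diagonal, $\varepsilon$ elsewhere), $c_0=0$, and for $1\le m\le n$, $c_m=\max_{J\subseteq[n],|J|=m}\ \max_{\sigma\in \mathrm{Sym}(J)}\sum_{i\in J}a_{i\sigma(i)}$. The tropical roots of a formal polynomial $P$ are: the points of $\mathbb{R}$ at which the maximum in the associated polynomial function is attained by at least two distinct monomials, and additionally $\varepsilon$ if $P$ has no constant term (i.e. its constant coefficient is $\varepsilon$). The tropical algebraic eigenvalues of $A$ are the tropical roots of $P_A$. A generalized tropical eigenvector of $A$ associated with a tropical algebraic eigenvalue $\lambda$ is a vector $x\in\mathbb{R}_{\max}^n$, $x\neq(\varepsilon,\ldots,\varepsilon)^T$,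 with $x^T\otimes A\otimes x=\lambda\otimes x^T\otimes x$. For $v\in\mathbb{R}_{\max}^n$, $v\neq(\varepsilon,\ldots,\varepsilon)^T$, $\Vert v\Vert=\max\{v_1,\ldots,v_n\}$. *)

(* Defs.v *)
From HB Require Import structures.
From mathcomp Require Import all_boot all_order all_fingroup all_algebra.
From mathcomp Require Import reals.

Set Implicit Arguments.
Unset Strict Implicit.
Unset Printing Implicit Defensive.

Import Order.TTheory GRing.Theory Num.Theory.
Local Open Scope ring_scope.

(* The max-plus semiring R u {-oo}. Beware that in ring_scope the semiring    *)
(* operations are the tropical ones: [0] is epsilon = -oo, [1] is the real    *)
(* number 0, [+] is max, [*] is addition of reals and [x ^+ k] is k times x.  *)
(* To avoid confusion, elements are written below with [eps] and [fin r].      *)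
Definition Rmax (R : realFieldType) : Type := option R.

Definition eps {R : realFieldType} : Rmax R := None.
Definition fin {R : realFieldType} (r : R) : Rmax R := Some r.

Section Tropical.
Variable R : realFieldType.
Implicit Types x y z : Rmax R.

HB.instance Definition _ := Choice.copy (Rmax R) (option R).

Definition tle x y : bool :=
  match x, y with
  | None, _ => true
  | Some _, None => false
  | Some r, Some s => r <= s
  end.

Fact tle_refl : reflexive tle.
Proof. by case=> //= r. Qed.

Fact tle_anti : antisymmetric tle.
Proof. by case=> [r|] [s|] //= /le_anti ->. Qed.

Fact tle_trans : transitive tle.
Proof. by case=> [r|] [s|] [t|] //=; apply: le_trans. Qed.

Fact tle_total : total tle.
Proof. by case=> [r|] [s|] //=; apply: le_total. Qed.

HB.instance Definition _ :=
  Order.Le_isPOrder.Build ring_display (Rmax R) tle_refl tle_anti tle_trans.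
HB.instance Definition _ :=
  Order.POrder_isTotal.Build ring_display (Rmax R) tle_total.

Definition tadd x y : Rmax R := Num.max x y.

Definition tmul x y : Rmax R :=
  match x, y with
  | Some r, Some s => fin (r + s)
  | _, _ => eps
  end.

Fact taddA : associative tadd.
Proof. exact: maxA. Qed.

Fact taddC : commutative tadd.
Proof. exact: maxC. Qed.

Fact tadd0 : left_id eps tadd.
Proof. by move=> x; apply/max_idPr. Qed.

HB.instance Definition _ := GRing.isNmodule.Build (Rmax R) taddA taddC tadd0.

Fact tmulA : associative tmul.
Proof. by case=> [r|] [s|] [t|] //=; rewrite addrA. Qed.

Fact tmulC : commutative tmul.
Proof. by case=> [r|] [s|] //=; rewrite addrC. Qed.

Fact tmul1 : left_id (fin 0) tmul.
Proof. by case=> [r|] //=; rewrite add0r. Qed.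

Fact tmul_le z : {homo tmul^~ z : x y / x <= y}.
Proof.
by case: z => [t|] [r|] [s|] // h; change (r + t <= s + t); rewrite lerD2r.
Qed.

Fact tmulDl : left_distributive tmul (@GRing.add (Rmax R)).
Proof.
move=> x y z; change (tmul (Num.max x y) z = Num.max (tmul x z) (tmul y z)).
have /orP[le_xy | le_yx] := le_total x y.
- by rewrite (max_idPr le_xy) (max_idPr (tmul_le z le_xy)).
- by rewrite (max_idPl le_yx) (max_idPl (tmul_le z le_yx)).
Qed.

Fact tmul0 : left_zero eps tmul.
Proof. by []. Qed.

Fact tone_neq0 : fin 0 != eps :> Rmax R.
Proof. by []. Qed.

HB.instance Definition _ := GRing.Nmodule_isComNzSemiRing.Build (Rmax R)
  tmulA tmulC tmul1 tmulDl tmul0 tone_neq0.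

(* Tropical inverse [- x]; it is undefined at epsilon, and the value eps      *)
(* chosen there makes eps * tinv y = eps for every y.                         *)
Definition tinv x : Rmax R := if x is Some r then fin (- r) else eps.

(* Classical halving [x / 2], with (-oo) / 2 = -oo. *)
Definition thalf x : Rmax R := if x is Some r then fin (r / 2) else eps.

(* Formal tropical polynomials are elements of {poly Rmax R}; the monomials   *)
(* of P are the P`_k * X^k with P`_k != eps.                                  *)
Definition attains_max (P : {poly Rmax R}) x (k : nat) : Prop :=
  P`_k <> eps /\ P`_k * x ^+ k = P.[x].

Definition tropical_root (P : {poly Rmax R}) x : Prop :=
  if x is Some _ then
    exists i j : nat, [/\ i <> j, attains_max P x i & attains_max P x j]
  else P`_0 = eps.

Definition permanent (S : comNzSemiRingType) (n : nat) (M : 'M[S]_n) : S :=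
  \sum_(s : 'S_n) \prod_(i < n) M i (s i).

Definition trop_char_poly (n : nat) (A : 'M[Rmax R]_n) : {poly Rmax R} :=
  permanent (map_mx polyC A + 'X%:M).

(* The coefficients c_k = max_{|J| = k} max_{s in Sym(J)} sum_{i in J} a_{i,s(i)}. *)
Lemma coef_trop_char_poly (n : nat) (A : 'M[Rmax R]_n) (k : nat) :
  (k <= n)%N ->
  (trop_char_poly A)`_(n - k) =
  \sum_(J : {set 'I_n} | #|J| == k) \sum_(s : 'S_n | perm_on J s)
     \prod_(i in J) A i (s i).
Proof.
move=> le_kn.
have -> : trop_char_poly A = \sum_(J : {set 'I_n}) \sum_(s : 'S_n | perm_on J s)
   (\prod_(i in J) A i (s i))%:P * 'X^(n - #|J|).
  rewrite (exchange_big_dep predT) //=; apply: eq_bigr => s _.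
  rewrite (eq_bigr (fun i => (A i (s i))%:P + 'X *+ (i == s i))); last first.
    by move=> i _; rewrite !mxE.
  rewrite bigA_distr (bigID (fun J : {set 'I_n} => perm_on J s)) /=.
  rewrite [X in _ + X]big1 ?addr0; last first.
    move=> J /subsetPn[i]; rewrite inE => si iJ.
    by rewrite (bigD1 i) //= (negPf iJ) eq_sym (negPf si) mulr0n mul0r.
  apply: eq_bigr => J sJ.
  rewrite (bigID (mem J)) /= rmorph_prod; congr (_ * _).
    by apply: eq_bigr => i ->.
  rewrite (eq_bigr (fun=> 'X)); last first.
    by move=> i iJ; rewrite (negPf iJ) (out_perm sJ iJ) eqxx.
  rewrite prodr_const; congr ('X^_); have := cardC J; rewrite card_ord => e.
  apply/eqP; rewrite -(eqn_add2l #|J|) subnKC; first by apply/eqP.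
  by have := max_card J; rewrite card_ord.
rewrite coef_sum [RHS]big_mkcond; apply: eq_bigr => J _.
rewrite coef_sum; have := max_card J; rewrite card_ord => le_Jn.
have [<-|neq] := eqVneq #|J| k.
  by apply: eq_bigr => s _; rewrite coefMXn ltnn subnn coefC.
apply: big1 => s _; rewrite mul_polyC coefZ coefXn.
have /negPf-> : (n - k != n - #|J|)%N; last by rewrite mulr0.
apply: contra neq => /eqP e.
by rewrite -(subKn le_kn) -(subKn le_Jn) e.
Qed.

Definition trop_alg_eigenvalue (n : nat) (A : 'M[Rmax R]_n) (lam : Rmax R) :
    Prop :=
  tropical_root (trop_char_poly A) lam.

Definition gen_trop_eigenvector (n : nat) (A : 'M[Rmax R]_n) (lam : Rmax R)
    (x : 'cV[Rmax R]_n) : Prop :=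
  [/\ trop_alg_eigenvalue A lam,
      x <> const_mx eps &
      x^T *m A *m x = lam *: (x^T *m x)].

Definition tnorm (n : nat) (v : 'cV[Rmax R]_n) : Rmax R :=
  \big[Num.max/eps]_(i < n) v i 0.

(* The vector with p-th entry 0, q-th entry t and all other entries -oo. When *)
(* p = q the entry is 0.                                                      *)
Definition two_entry_vector (n : nat) (p q : 'I_n) (t : Rmax R) :
    'cV[Rmax R]_n :=
  \col_i (if i == p then fin 0 else if i == q then t else eps).

End Tropical.

(* Main.v *)
(* A tropical eigenvalue lam is at least min_i a_ii: if every diagonal entry  *)
(* exceeded lam, adding a fixed point to a partial permutation would beat the *)
(* factor lam, so the monomials of the characteristic polynomial at lam would *)
(* strictly decrease in the degree and the maximum would be attained once.    *)
(* Hence a_pp <= lam. On a vector with entries 0 at p and t <= 0 at q, the    *)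
(* quadratic form is max(a_pp, t + m, 2 t + a_qq) with                        *)
(* m = max(a_pq, a_qp); in each case the chosen t makes one of the last two   *)
(* terms equal to lam and the other at most lam.                              *)
Require Import Defs.
From HB Require Import structures.
From mathcomp Require Import all_boot all_order all_fingroup all_algebra.
From mathcomp Require Import reals.
From mathcomp Require Import lra.

Set Implicit Arguments.
Unset Strict Implicit.
Unset Printing Implicit Defensive.

Import Order.TTheory GRing.Theory Num.Theory.
Local Open Scope ring_scope.

(** Two facts carry the proof. [eigenvalue_ge_min_diag] bounds the term a_pp by lam.
    [gen_trop_eigenvector_two_entry] reduces the claim to one scalar equation, a_pp + t m + a_qq t^2
    = lam in tropical notation, with t <= 0. Each choice of t solves the equation by making one
    t-term equal to lam; lam <= a_qq yields t <= 0 and, if p = q, forces a_pp = lam. *)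

Section TropicalOrder.
Variable R : realFieldType.
Implicit Types x y z : Rmax R.

Lemma Rmax_addE x y : x + y = Num.max x y. Proof. by []. Qed.

Lemma lee_fin (r s : R) : (fin r <= fin s :> Rmax R) = (r <= s).
Proof. by []. Qed.

Lemma lte_fin (r s : R) : (fin r < fin s :> Rmax R) = (r < s).
Proof. by rewrite !ltNge lee_fin. Qed.

Lemma le_eps x : (x <= eps) = (x == eps).
Proof. by case: x. Qed.

Lemma fin_mul (r s : R) : fin r * fin s = fin (r + s) :> Rmax R.
Proof. by []. Qed.

Lemma fin_sqr (r : R) : fin r ^+ 2 = fin (r + r) :> Rmax R.
Proof. by []. Qed.

Lemma Rmax_ler_wpM2r z : {homo *%R^~ z : x y / x <= y}.
Proof. exact: tmul_le. Qed.

Lemma Rmax_ltr_pM2r z : z <> eps -> {homo *%R^~ z : x y / x < y}.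
Proof.
case: z => [t|] // _ [r|] [s|] //; rewrite /= -/(fin _) -/(fin s).
by rewrite !fin_mul !lte_fin ltrD2r.
Qed.

Lemma Rmax_expr_neq_eps x k : x <> eps -> x ^+ k <> eps.
Proof.
move=> x_fin; elim: k => [//|k]; rewrite exprS.
by case: x (x ^+ k) x_fin => [r|] [s|].
Qed.

Lemma le_Rmax_sum (I : finType) (P : pred I) (F : I -> Rmax R) i :
  P i -> F i <= \sum_(j | P j) F j.
Proof. by move=> Pi; rewrite (bigD1 i) //= Rmax_addE le_max lexx. Qed.

Lemma Rmax_sum_attained (I : finType) (P : pred I) (F : I -> Rmax R) :
  \sum_(i | P i) F i <> eps -> exists2 i, P i & \sum_(j | P j) F j = F i.
Proof.
elim/big_ind: _ => [//|x y IHx IHy|i Pi _]; last by exists i.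
by rewrite Rmax_addE; case: (leP x y).
Qed.

Lemma Rmax_prod_eq_eps (I : finType) (P : pred I) (F : I -> Rmax R) :
  \prod_(i | P i) F i = eps -> exists2 i, P i & F i = eps.
Proof.
elim/big_ind: _ => [//|x y IHx IHy|i Pi Fi]; last by exists i.
by case: x y IHx IHy => [r|] [s|] IHx IHy //=.
Qed.

Lemma le_horner_coef (P : {poly Rmax R}) x k : P`_k * x ^+ k <= P.[x].
Proof.
have [kP|kP] := ltnP k (size P).
  by rewrite horner_coef (le_Rmax_sum _ (i := Ordinal kP)).
by rewrite nth_default // mul0r.
Qed.

End TropicalOrder.

Section MinDiagonal.
Variables (R : realFieldType) (n : nat) (A : 'M[Rmax R]_n).

Lemma size_trop_char_poly : (size (trop_char_poly A) <= n.+1)%N.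
Proof.
apply: (leq_trans (size_sum _ _ _)); apply/bigmax_leqP => s _.
apply: (leq_trans (size_poly_prod_leq _ _)).
rewrite leq_subLR cardT size_enum_ord addnS ltnS addnn -muln2.
rewrite -[X in (_ <= X * _)%N]card_ord -sum_nat_const leq_sum // => i _.
rewrite !mxE; apply: (leq_trans (size_polyD _ _)); rewrite geq_max.
rewrite (leq_trans (size_polyC_leq1 _)) //=.
by case: eqP => _; rewrite ?mulr1n ?mulr0n ?size_polyX ?size_poly0.
Qed.

(* If (J, s) attains the coefficient of X^k+1, then adding to J a fixed point *)
(* i replaces one factor lam by the larger a_ii.                              *)
Lemma trop_char_poly_monomial_lt (lam : Rmax R) k :
  lam <> eps -> (forall i, lam < A i i) -> (trop_char_poly A)`_k.+1 <> eps ->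
  (trop_char_poly A)`_k.+1 * lam ^+ k.+1 < (trop_char_poly A)`_k * lam ^+ k.
Proof.
move=> lam_fin lamA ck_fin.
have lt_kn : (k < n)%N.
  rewrite ltnNge; apply/negP => le_nk; apply: ck_fin.
  by apply: nth_default; apply: (leq_trans size_trop_char_poly).
have := coef_trop_char_poly A (leq_subr k.+1 n); rewrite subKn // => ck.
have := ck_fin; rewrite ck => /Rmax_sum_attained[J /eqP cJ eJ].
have := ck_fin; rewrite ck eJ => /Rmax_sum_attained[s sJ es].
have [i iJ] : exists i, i \notin J.
  apply/existsP; rewrite -negb_forall; apply/negP => /forallP JT.
  have : (#|J| < n)%N by rewrite cJ ltn_subrL (leq_trans _ lt_kn).
  by rewrite (eq_card (B := 'I_n)) ?card_ord ?ltnn // => j; rewrite JT.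
set w := \prod_(j in J) _ in es.
(* Multiplication preserves strict inequalities only when the factor is not eps. *)
have w_fin : w <> eps by rewrite -es -eJ -ck.
have le_w : A i i * w <= (trop_char_poly A)`_k.
  have := coef_trop_char_poly A (leq_subr k n); rewrite subKn 1?ltnW // => ->.
  apply: (le_trans _ (le_Rmax_sum _ (i := i |: J) _)); last first.
    by rewrite cardsU1 iJ cJ add1n subnSK.
  (* The same [s] serves on the larger set: it fixes [i], so the extra factor is a_ii. *)
  apply: (le_trans _ (le_Rmax_sum _ (i := s) _)); last first.
    exact: subset_trans sJ (subsetUr _ _).
  by rewrite big_setU1 //= (out_perm sJ iJ).
apply: (lt_le_trans _ (Rmax_ler_wpM2r _ le_w)).
rewrite es exprS mulrA; apply: Rmax_ltr_pM2r.
  exact: Rmax_expr_neq_eps.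
by rewrite mulrC; apply: Rmax_ltr_pM2r.
Qed.

Lemma eigenvalue_ge_min_diag (lam : Rmax R) p :
  trop_alg_eigenvalue A lam -> (forall i, A p p <= A i i) -> A p p <= lam.
Proof.
case: lam => [l|] hlam App_min; last first.
  have := hlam; rewrite /trop_alg_eigenvalue /= => c0.
  (* The identity permutation competes in the constant coefficient, which is eps; so some diagonal
     entry is eps, and the minimal one too. *)
  have : \prod_i A i ((1%g : 'S_n) i) = eps.
    apply/eqP; rewrite -le_eps -c0 -{1}(subnn n) coef_trop_char_poly //.
    rewrite (le_trans _ (le_Rmax_sum _ (i := setT) _)) ?cardsT ?card_ord //.
    rewrite (le_trans _ (le_Rmax_sum _ (i := 1%g) _)) ?perm_on1 //.
    by rewrite le_eqVlt; apply/orP; left; apply/eqP/eq_bigl => i; rewrite inE.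
  case/Rmax_prod_eq_eps => i _; rewrite perm1 => Ai.
  by rewrite -[None]/eps -Ai.
rewrite leNgt; apply/negP => lamApp.
have lamA i : fin l < A i i by apply: lt_le_trans (App_min i).
(* A monomial of positive degree is strictly beaten by the one of the preceding degree, so two
   distinct maximizers cannot exist. *)
have attained0 k : attains_max (trop_char_poly A) (fin l) k -> k = 0%N.
  case: k => // k [ck_fin ck].
  have := trop_char_poly_monomial_lt (lam := fin l) _ lamA ck_fin.
  by rewrite ck ltNge le_horner_coef => lt_max; case: (lt_max _).
by case: hlam => i [j [ij /attained0 i0 /attained0 j0]]; rewrite i0 j0 in ij.
Qed.

End MinDiagonal.

Section TwoEntry.
Variables (R : realFieldType) (n : nat) (A : 'M[Rmax R]_n) (p q : 'I_n).
Implicit Types (lam t : Rmax R).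

(** If p = q the two positions coincide, and the weight eps removes the spurious second term. *)
Lemma two_entry_vector_sum t (F : 'I_n -> Rmax R) :
  \sum_i two_entry_vector p q t i 0 * F i =
  F p + (if p == q then eps else t) * F q.
Proof.
rewrite (bigD1 p) //= mxE eqxx mul1r; congr (_ + _).
have [<-|pq] := eqVneq p q.
  by rewrite mul0r big1 // => i ip; rewrite mxE (negPf ip) mul0r.
rewrite (bigD1 q) 1?eq_sym //= mxE eq_sym (negPf pq) eqxx big1 ?addr0 //.
by move=> i /andP[ip iq]; rewrite mxE (negPf ip) (negPf iq) mul0r.
Qed.

Lemma two_entry_vector_form t (B : 'M[Rmax R]_n)
    (x := two_entry_vector p q t) (s := if p == q then eps else t) :
  (x^T *m B *m x) 0 0 =
  B p p + s * Num.max (B p q) (B q p) + B q q * s ^+ 2.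
Proof.
rewrite mxE; under eq_bigr => j _.
  rewrite mulrC [(x^T *m B) 0 j]mxE; under eq_bigr => i _ do rewrite mxE.
  rewrite two_entry_vector_sum; over.
rewrite two_entry_vector_sum -/s -Rmax_addE !mulrDr expr2 (mulrC (B q q)).
by rewrite !mulrA !addrA (addrAC (B p p)).
Qed.

(** Since t <= 0, the largest entry is the real 0 at p, so x^T x is the tropical unit and only the
    quadratic form has to be matched with lam. If p = q the form collapses to a_pp, whence the
    separate hypothesis. *)
Lemma gen_trop_eigenvector_two_entry lam t :
  trop_alg_eigenvalue A lam -> t <= fin 0 -> (p = q -> A p p = lam) ->
  A p p + t * Num.max (A p q) (A q p) + A q q * t ^+ 2 = lam ->
  let x := two_entry_vector p q t in
  gen_trop_eigenvector A lam x /\ tnorm x = fin 0.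
Proof.
move=> hlam t_le0 App form_t x.
split; [split=> //|].
- move/matrixP/(_ p 0); rewrite !mxE eqxx; exact: (elimN eqP (tone_neq0 R)).
- apply/matrixP => i j; rewrite !ord1 two_entry_vector_form mxE.
  have -> : (x^T *m x) 0 0 = 1.
    rewrite mxE; under eq_bigr do rewrite mxE.
    rewrite two_entry_vector_sum !mxE eqxx.
    have [pq|pq] := eqVneq p q; first by rewrite mul0r addr0.
    rewrite eqxx Rmax_addE; apply/max_idPl.
    case: t t_le0 {form_t x} => [r|] //; rewrite fin_mul !lee_fin => r_le0.
    by rewrite -[0]addr0 lerD.
  have [pq|_] := eqVneq p q.
    by rewrite mul0r expr0n mulr0 !addr0 mulr1 App.
  by rewrite form_t mulr1.
- rewrite /tnorm.
  have -> : \big[Num.max/eps]_(i < n) x i 0 = \sum_i x i 0 * fin 0.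
    by apply: eq_bigr => i _; rewrite mulr1.
  rewrite two_entry_vector_sum mulr1 Rmax_addE; apply/max_idPl.
  by case: ifP.
Qed.

End TwoEntry.

Theorem theorem5p2 (R : realType) (n : nat) (A : 'M[Rmax R]_n) (lam : Rmax R)
    (hlam : trop_alg_eigenvalue A lam)
    (q : 'I_n) (hq : A q q >= lam)
    (p : 'I_n) (hp : forall i : 'I_n, A p p <= A i i) :
  let m := Num.max (A p q) (A q p) in
  (lam * A q q <= m ^+ 2 ->
     let x := two_entry_vector p q (lam * tinv m) in
     gen_trop_eigenvector A lam x /\ tnorm x = fin 0) /\
  (lam * A q q >= m ^+ 2 ->
     let x := two_entry_vector p q (thalf (lam * tinv (A q q))) in
     gen_trop_eigenvector A lam x /\ tnorm x = fin 0).
Proof.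
have App_le := eigenvalue_ge_min_diag hlam hp.
have App_eq : p = q -> A p p = lam.
  by move=> pq; apply: le_anti; rewrite App_le pq hq.
move=> m; case: lam => [l|] in hlam hq App_le App_eq *; last first.
  (* For lam = eps both choices of t are eps, and every term of the form is eps. *)
  have /eqP App : A p p == eps by rewrite -le_eps.
  by split=> _; apply: gen_trop_eigenvector_two_entry => //;
    rewrite App ?expr2 !(mul0r, mulr0) ?addr0.
case Aqq : (A q q) hq => [a|] //; rewrite lee_fin => l_le_a.
split.
(* Here m = eps is impossible because l + a is finite; 2l <= l + a <= 2b gives t = l - b <= 0, and a
   + 2t <= l. *)
- case Em : m => [b|] //; rewrite fin_mul fin_sqr lee_fin => lab.
  apply: gen_trop_eigenvector_two_entry => //.
    by rewrite fin_mul lee_fin; lra.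
  rewrite -/m Em Aqq /= fin_mul fin_sqr !fin_mul subrK.
  rewrite 2!Rmax_addE (max_idPr App_le); apply/max_idPl.
  by rewrite lee_fin; lra.
- rewrite fin_mul => m_le.
  apply: gen_trop_eigenvector_two_entry => //.
    by rewrite lee_fin; lra.
  (* Now a + 2t = l exactly, and m <= (l + a) / 2 bounds the cross term by l. *)
  rewrite -/m Aqq /= fin_sqr fin_mul -splitr (addrC a) subrK.
  rewrite 2!Rmax_addE; apply/max_idPr; rewrite ge_max App_le /=.
  case: m m_le => [b|] //; rewrite fin_sqr fin_mul !lee_fin => m_le.
  by lra.
Qed.
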